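(* Let $k$ be a field, $G$ an algebraic group over $k$, $X$ a $G$-variety, $\mathcal{C}$ a fibered category over the category $\mathbf{Sch}_k$ of $k$-schemes, and $E$ an object of $\mathcal{C}(X)$. Then $E$ admits a $G$-linearization (i.e. a $G$-equivariant structure) if and only if the homomorphism $\widetilde{G}_E\to G$ admits a section which is also a homomorphism.
   Context: Let $\pi:G\times X\to X$ be the projection, $\sigma:G\times X\to X$ the action, $m:G\times G\to G$ the multiplication, and $\pi_{23}:G\times G\times X\to G\times X$ the projection onto the last two factors. A $G$-equivariant structure on $E$ is an isomorphism $\phi:\pi^*E\to\sigma^*E$ in $\mathcal{C}(G\times X)$ satisfying the cocycle condition $(\mathrm{id}_G\times\sigma)^*\phi\circ\pi_{23}^*\phi=(m\times\mathrm{id}_X)^*\phi$ on $G\times G\times X$ (with the canonical identifications of pullbacks). The functor $\widetilde{G}_E:\mathbf{Sch}_k^{\mathrm{op}}\to\mathrm{Set}$ sends a $k$-scheme $T$ to the set of pairs $(g,\alpha)$ with $g:T\to G$ a morphism and $\alpha:(g\times\mathrm{id}_X)^*\sigma^*E\to(g\times\mathrm{id}_X)^*\pi^*E$ an isomorphism in $\mathcal{C}(T\times X)$. Writing $a_g:T\times X\to T\times X$ for $(t,x)\mapsto(t,g(t)x)$, its group law is $(g_1,\alpha_1)\cdot(g_2,\alpha_2)=(g_1g_2,\ \alpha_2\circ a_{g_2}^*\alpha_1)$. The homomorphism $\widetilde{G}_E\to G$ is $(g,\alpha)\mapsto g$. *)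

(* Defs.v *)
From HB Require Import structures.
From mathcomp Require Import all_boot all_algebra.
From mathcomp Require Import boolp classical_sets topology_structure.

Set Implicit Arguments.
Unset Strict Implicit.
Unset Printing Implicit Defensive.

Import GRing.Theory.
Local Open Scope classical_set_scope.
Local Open Scope ring_scope.

Record category := Category {
  obj :> Type;
  hom : obj -> obj -> Type;
  idm : forall A, hom A A;
  mcomp : forall A B D, hom B D -> hom A B -> hom A D;
  comp1m : forall A B (f : hom A B), mcomp (idm B) f = f;
  compm1 : forall A B (f : hom A B), mcomp f (idm A) = f;
  compA : forall A B D H (h : hom D H) (g : hom B D) (f : hom A B),
    mcomp h (mcomp g f) = mcomp (mcomp h g) f }.

Arguments idm {c} A.
Arguments mcomp {c A B D}.

Notation "g \oc f" := (mcomp g f) (at level 40, left associativity).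

Definition is_iso (S : category) (A B : S) (f : hom A B) : Prop :=
  exists g : hom B A, g \oc f = idm A /\ f \oc g = idm B.

Lemma is_iso_comp (S : category) (A B D : S) (g : hom B D) (f : hom A B) :
  is_iso g -> is_iso f -> is_iso (g \oc f).
Proof.
move=> [g' [g1 g2]] [f' [f1 f2]]; exists (f' \oc g'); split.
- by rewrite compA -(compA f') g1 compm1.
- by rewrite compA -(compA g) f2 compm1.
Qed.

Record finite_products (S : category) := FiniteProducts {
  one : S;
  to_one : forall T, hom T one;
  to_one_uniq : forall T (f : hom T one), f = to_one T;
  xprod : S -> S -> S;
  pr1 : forall A B, hom (xprod A B) A;
  pr2 : forall A B, hom (xprod A B) B;
  xpair : forall T A B, hom T A -> hom T B -> hom T (xprod A B);
  pr1_pair : forall T A B (a : hom T A) (b : hom T B), pr1 A B \oc xpair a b = a;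
  pr2_pair : forall T A B (a : hom T A) (b : hom T B), pr2 A B \oc xpair a b = b;
  pair_uniq : forall T A B (c : hom T (xprod A B)),
    c = xpair (pr1 A B \oc c) (pr2 A B \oc c) }.

Arguments pr1 {S f0 A B}.
Arguments pr2 {S f0 A B}.
Arguments xpair {S f0 T A B}.

Section Products.
Variables (S : category) (P : finite_products S).
Local Notation "A '\x' B" := (xprod P A B) (at level 40, left associativity).

Definition prod_map (A A' B B' : S) (a : hom A A') (b : hom B B') :
  hom (A \x B) (A' \x B') := xpair (a \oc pr1) (b \oc pr2).

Lemma pair_comp (T' T A B : S) (a : hom T A) (b : hom T B) (h : hom T' T) :
  (xpair a b : hom T (A \x B)) \oc h = xpair (a \oc h) (b \oc h).
Proof. by rewrite [LHS]pair_uniq !compA pr1_pair pr2_pair. Qed.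

Lemma prod_map_pair (T A A' B B' : S) (a : hom A A') (b : hom B B')
    (u : hom T A) (v : hom T B) :
  prod_map a b \oc xpair u v = xpair (a \oc u) (b \oc v).
Proof. by rewrite /prod_map pair_comp -!compA pr1_pair pr2_pair. Qed.

Record group_object := GroupObject {
  gob :> S;
  gmul : hom (gob \x gob) gob;
  gone : hom (one P) gob;
  ginv : hom gob gob;
  gmulA : gmul \oc prod_map gmul (idm gob)
        = gmul \oc xpair (pr1 \oc pr1) (gmul \oc xpair (pr2 \oc pr1) pr2);
  gmul1l : gmul \oc xpair (gone \oc to_one P gob) (idm gob) = idm gob;
  gmul1r : gmul \oc xpair (idm gob) (gone \oc to_one P gob) = idm gob;
  gmulVl : gmul \oc xpair ginv (idm gob) = gone \oc to_one P gob;
  gmulVr : gmul \oc xpair (idm gob) ginv = gone \oc to_one P gob }.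

Definition gmulT (G : group_object) (T : S) (g1 g2 : hom T G) : hom T G :=
  gmul G \oc xpair g1 g2.

Section Action.
Variables (G : group_object) (X : S).

(* The three arrows G x G x X -> G x X; the triple product is bracketed to
   the left. *)
Definition pr23 : hom (G \x G \x X) (G \x X) := xpair (pr2 \oc pr1) pr2.

Definition id_x (s : hom (G \x X) X) : hom (G \x G \x X) (G \x X) :=
  xpair (pr1 \oc pr1) (s \oc pr23).

Definition m_x_id : hom (G \x G \x X) (G \x X) := prod_map (gmul G) (idm X).

Record action := Action {
  act :> hom (G \x X) X;
  act_mul : act \oc id_x act = act \oc m_x_id;
  act_one : act \oc xpair (gone G \oc to_one P X) (idm X) = idm X }.

End Action.
End Products.

(* A functor p from a category F to S, presented by its fibres: an object of F
   is a xpair (X, E) with [E : fob X], and p sends (X, E) to X and an arrow [u]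
   to [fproj u]. *)
Record category_over (S : category) := CategoryOver {
  fob :> S -> Type;
  fhom : forall X Y : S, fob X -> fob Y -> Type;
  fproj : forall (X Y : S) (E : fob X) (F : fob Y), fhom E F -> hom X Y;
  fid : forall (X : S) (E : fob X), fhom E E;
  fcomp : forall (X Y Z : S) (E : fob X) (F : fob Y) (H : fob Z),
    fhom F H -> fhom E F -> fhom E H;
  fcomp1m : forall (X Y : S) (E : fob X) (F : fob Y) (u : fhom E F),
    fcomp (fid F) u = u;
  fcompm1 : forall (X Y : S) (E : fob X) (F : fob Y) (u : fhom E F),
    fcomp u (fid E) = u;
  fcompA : forall (X Y Z W : S) (E : fob X) (F : fob Y) (H : fob Z)
    (K : fob W) (w : fhom H K) (v : fhom F H) (u : fhom E F),
    fcomp w (fcomp v u) = fcomp (fcomp w v) u;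
  fproj1 : forall (X : S) (E : fob X), fproj (fid E) = idm X;
  fprojM : forall (X Y Z : S) (E : fob X) (F : fob Y) (H : fob Z)
    (v : fhom F H) (u : fhom E F),
    fproj (fcomp v u) = fproj v \oc fproj u }.

Arguments fcomp {S c X Y Z E F H}.
Arguments fproj {S c X Y E F}.
Arguments fid {S c X}.

Definition cartesian (S : category) (C : category_over S) (X Y : S)
    (D : C X) (E : C Y) (c : fhom D E) : Prop :=
  forall (Z : S) (H : C Z) (g : hom Z X) (w : fhom H E),
    fproj w = fproj c \oc g ->
    exists! u : fhom H D, fproj u = g /\ fcomp c u = w.

(* A fibered category together with a chosen cleavage, that is, a choice of
   pullbacks f^*E. *)
Record fibered_category (S : category) := FiberedCategory {
  fcat :> category_over S;
  pull : forall (X Y : S) (f : hom X Y), fcat Y -> fcat X;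
  cart : forall (X Y : S) (f : hom X Y) (E : fcat Y), fhom (pull f E) E;
  cart_proj : forall (X Y : S) (f : hom X Y) (E : fcat Y),
    fproj (cart f E) = f;
  cart_cartesian : forall (X Y : S) (f : hom X Y) (E : fcat Y),
    cartesian (cart f E) }.

Lemma sig_eq (T : Type) (Q : T -> Prop) (u v : {x | Q x}) :
  sval u = sval v -> u = v.
Proof.
case: u v => u hu [v hv] /= e; case: _ / e hv => hv.
by congr exist; exact: Prop_irrelevance.
Qed.

Arguments cart_cartesian {S} _ {X Y} f E.

Section Fiber.
Variables (S : category) (C : category_over S) (X : S).

Definition vhom (E F : C X) := {u : fhom E F | fproj u = idm X}.

Lemma vhom_eq (E F : C X) (u v : vhom E F) : sval u = sval v -> u = v.
Proof. exact: sig_eq. Qed.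

Definition vid (E : C X) : vhom E E := exist _ (fid E) (fproj1 E).

Lemma vcomp_subproof (E F H : C X) (v : vhom F H) (u : vhom E F) :
  fproj (fcomp (sval v) (sval u)) = idm X.
Proof. by rewrite fprojM (svalP u) (svalP v) comp1m. Qed.

Definition vcomp (E F H : C X) (v : vhom F H) (u : vhom E F) : vhom E H :=
  exist _ (fcomp (sval v) (sval u)) (vcomp_subproof v u).

Definition fiber : category.
Proof.
apply: (@Category (C X) vhom vid vcomp).
- by move=> E F u; apply: vhom_eq; rewrite /= fcomp1m.
- by move=> E F u; apply: vhom_eq; rewrite /= fcompm1.
- by move=> E F H K w v u; apply: vhom_eq; rewrite /= fcompA.
Defined.

End Fiber.

Section Pullbacks.
Variables (S : category) (C : fibered_category S).

Lemma cartesian_comp (X Y Z : S) (E : C X) (F : C Y) (H : C Z)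
    (v : fhom F H) (u : fhom E F) :
  cartesian v -> cartesian u -> cartesian (fcomp v u).
Proof.
move=> cv cu W K g w; rewrite fprojM -compA => ew.
have [a [[a1 a2] a3]] := cv _ _ _ _ ew.
have [b [[b1 b2] b3]] := cu _ _ _ _ a1.
exists b; split; first by rewrite -fcompA b2.
move=> b' [b'1 b'2]; apply: b3; split=> //.
apply/esym/a3; split; first by rewrite fprojM b'1.
by rewrite fcompA.
Qed.

(* A pullback of E along h, in the sense of a cartesian arrow over h. *)
Record pullback (X Y : S) (h : hom X Y) (E : C Y) := Pullback {
  pbob : C X;
  pbarr : fhom pbob E;
  pbarr_proj : fproj pbarr = h;
  pbarr_cartesian : cartesian pbarr }.

Arguments pbarr_cartesian {X Y h E} _.

Definition pb1 (X Y : S) (f : hom X Y) (E : C Y) : pullback f E :=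
  Pullback (cart_proj f E) (cart_cartesian C f E).

(* If D is a pullback of E along h, then u^*D is one along h u; thus
   [pbS u (pb1 f E)] is u^*f^*E, as a pullback of E along f u. *)
Lemma pbS_subproof (Z X Y : S) (u : hom Z X) (h : hom X Y) (E : C Y)
    (D : pullback h E) :
  fproj (fcomp (pbarr D) (cart u (pbob D))) = h \oc u.
Proof. by rewrite fprojM cart_proj pbarr_proj. Qed.

Definition pbS (Z X Y : S) (u : hom Z X) (h : hom X Y) (E : C Y)
    (D : pullback h E) : pullback (h \oc u) E :=
  Pullback (pbS_subproof u D)
    (cartesian_comp (pbarr_cartesian D) (cart_cartesian C u (pbob D))).

Section Canon.
Variables (X Y : S) (E : C Y).

Lemma canon_subproof (h h' : hom X Y) (D : pullback h E) (D' : pullback h' E) :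
  h = h' -> exists! c : fhom (pbob D) (pbob D'),
    fproj c = idm X /\ fcomp (pbarr D') c = pbarr D.
Proof.
by move=> e; apply: (pbarr_cartesian D'); rewrite !pbarr_proj compm1.
Qed.

(* The canonical identification of two pullbacks of E along the same arrow:
   the unique arrow of C(X) compatible with the two cartesian arrows to E. *)
Definition canon (h h' : hom X Y) (D : pullback h E) (D' : pullback h' E)
    (e : h = h') : @hom (fiber C X) (pbob D) (pbob D') :=
  let c := cid (canon_subproof D D' e) in
  exist _ (sval c) (proj1 (proj1 (svalP c))).

Lemma canonE (h h' : hom X Y) (D : pullback h E) (D' : pullback h' E)
    (e : h = h') : fcomp (pbarr D') (sval (canon D D' e)) = pbarr D.
Proof. by rewrite /canon; case: cid => c [[]]. Qed.

Lemma canonK (h h' : hom X Y) (D : pullback h E) (D' : pullback h' E)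
    (e : h = h') (e' : h' = h) :
  canon D' D e' \oc canon D D' e = idm (pbob D : fiber C X).
Proof.
have [c [_ cu]] := canon_subproof D D erefl.
apply: vhom_eq; rewrite -(cu (sval (canon D' D e' \oc canon D D' e))).
  by apply: cu; split; [exact: fproj1|rewrite fcompm1].
split; first exact: (svalP (canon D' D e' \oc canon D D' e)).
by rewrite /= fcompA !canonE.
Qed.

Lemma canon_iso (h h' : hom X Y) (D : pullback h E) (D' : pullback h' E)
    (e : h = h') : is_iso (canon D D' e).
Proof. by exists (canon D' D (esym e)); split; exact: canonK. Qed.

End Canon.

Section PullMap.
Variables (X Y : S) (f : hom X Y).

Lemma pullm_subproof (E F : C Y) (a : @hom (fiber C Y) E F) :
  exists! b : fhom (pull f E) (pull f F),
    fproj b = idm X /\ fcomp (cart f F) b = fcomp (sval a) (cart f E).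
Proof.
by apply: (cart_cartesian C f F); rewrite fprojM !cart_proj (svalP a) comp1m compm1.
Qed.

(* The functor f^* : C(Y) -> C(X) on arrows. *)
Definition pullm (E F : C Y) (a : @hom (fiber C Y) E F) :
    @hom (fiber C X) (pull f E) (pull f F) :=
  let b := cid (pullm_subproof a) in
  exist _ (sval b) (proj1 (proj1 (svalP b))).

Lemma pullmE (E F : C Y) (a : @hom (fiber C Y) E F) :
  fcomp (cart f F) (sval (pullm a)) = fcomp (sval a) (cart f E).
Proof. by rewrite /pullm; case: cid => c [[]]. Qed.

Lemma pullm_eq (E F : C Y) (a : @hom (fiber C Y) E F)
    (b : @hom (fiber C X) (pull f E) (pull f F)) :
  fcomp (cart f F) (sval b) = fcomp (sval a) (cart f E) -> pullm a = b.
Proof.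
have [c [_ cu]] := pullm_subproof a; move=> eb; apply: vhom_eq.
rewrite -(cu (sval b)); last by split=> //; exact: (svalP b).
apply/esym/cu; split; [exact: (svalP (pullm a))|exact: pullmE].
Qed.

Lemma pullm1 (E : C Y) :
  pullm (idm (E : fiber C Y)) = idm (pull f E : fiber C X).
Proof. by apply: pullm_eq; rewrite /= fcomp1m fcompm1. Qed.

Lemma pullmM (E F H : C Y) (b : @hom (fiber C Y) F H)
    (a : @hom (fiber C Y) E F) : pullm (b \oc a) = pullm b \oc pullm a.
Proof.
by apply: pullm_eq; rewrite /= fcompA pullmE -!fcompA pullmE.
Qed.

Lemma pullm_iso (E F : C Y) (a : @hom (fiber C Y) E F) :
  is_iso a -> is_iso (pullm a).
Proof.
move=> [b [ba ab]]; exists (pullm b).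
by split; rewrite -pullmM ?ba ?ab pullm1.
Qed.

End PullMap.
End Pullbacks.


Section Equivariant.
Variables (S : category) (P : finite_products S) (G : group_object P) (X : S).
Variables (s : action G X) (C : fibered_category S) (E : C X).
Local Notation "A '\x' B" := (xprod P A B) (at level 40, left associativity).
Local Notation p := (@pr2 S P G X).
Local Notation sg := (act s).

Lemma p_pr23 : p \oc pr23 G X = p \oc m_x_id G X.
Proof. by rewrite !pr2_pair comp1m. Qed.

Lemma s_pr23 : sg \oc pr23 G X = p \oc id_x sg.
Proof. by rewrite /id_x pr2_pair. Qed.

(* The cocycle condition, with source pr23^*p^*E and target (m x id)^*s^*E. *)
Definition cocycle (phi : @hom (fiber C (G \x X)) (pull p E) (pull sg E)) :
    Prop :=
  canon (pbS (id_x sg) (pb1 sg E)) (pbS (m_x_id G X) (pb1 sg E)) (act_mul s)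
    \oc pullm (id_x sg) phi
    \oc canon (pbS (pr23 G X) (pb1 sg E)) (pbS (id_x sg) (pb1 p E)) s_pr23
    \oc pullm (pr23 G X) phi
  = pullm (m_x_id G X) phi
    \oc canon (pbS (pr23 G X) (pb1 p E)) (pbS (m_x_id G X) (pb1 p E)) p_pr23.

Record equivariant_structure := EquivariantStructure {
  eqv :> @hom (fiber C (G \x X)) (pull p E) (pull sg E);
  eqv_iso : is_iso eqv;
  eqv_cocycle : cocycle eqv }.

(* g x id_X : T x X -> G x X *)
Definition gx (T : S) (g : hom T G) : hom (T \x X) (G \x X) :=
  prod_map P g (idm X).

Record Gtilde (T : S) := GTilde {
  gt_pt : hom T G;
  gt_arr : @hom (fiber C (T \x X)) (pull (gx gt_pt) (pull sg E))
                                   (pull (gx gt_pt) (pull p E));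
  gt_iso : is_iso gt_arr }.

(* The endpoints of [canon D D' e] are usually displayed in the unfolded form
   [pull f E], which unification does not match with [pbob D]. *)
Ltac iso_tac :=
  lazymatch goal with
  | |- is_iso (_ \oc _) => apply: is_iso_comp; iso_tac
  | |- is_iso (canon ?D ?D' ?e) => exact: (canon_iso D D' e)
  | |- is_iso (pullm _ _) => apply: pullm_iso; iso_tac
  | |- is_iso (gt_arr _) => exact: gt_iso
  end.

Section Restriction.
Variables (T' T : S) (h : hom T' T).

Lemma gx_comp (g : hom T G) (q : hom (G \x X) X) :
  q \oc gx (g \oc h) = q \oc gx g \oc prod_map P h (idm X).
Proof.
by rewrite -compA /gx {2}/prod_map prod_map_pair comp1m compA.
Qed.

Definition Gtilde_res_arr (x : Gtilde T) :
    @hom (fiber C (T' \x X)) (pull (gx (gt_pt x \oc h)) (pull sg E))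
                             (pull (gx (gt_pt x \oc h)) (pull p E)) :=
  let hx := prod_map P h (idm X) in
  let g := gt_pt x in
  canon (pbS hx (pbS (gx g) (pb1 p E))) (pbS (gx (g \oc h)) (pb1 p E))
        (esym (gx_comp g p))
    \oc pullm hx (gt_arr x)
    \oc canon (pbS (gx (g \oc h)) (pb1 sg E)) (pbS hx (pbS (gx g) (pb1 sg E)))
          (gx_comp g sg).

Lemma Gtilde_res_iso (x : Gtilde T) : is_iso (Gtilde_res_arr x).
Proof. by rewrite /Gtilde_res_arr; iso_tac. Qed.

Definition Gtilde_res (x : Gtilde T) : Gtilde T' :=
  GTilde (Gtilde_res_iso x).

End Restriction.

Section GroupLaw.
Variable T : S.

(* a_g : (t, x) |-> (t, g(t) x) *)
Definition a_ (g : hom T G) : hom (T \x X) (T \x X) :=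
  xpair pr1 (sg \oc gx g).

Lemma s_gx_mul (g1 g2 : hom T G) :
  sg \oc gx (gmulT g1 g2) = sg \oc gx g1 \oc a_ g2.
Proof.
pose w : hom (T \x X) (G \x G \x X) := prod_map P (xpair g1 g2) (idm X).
have -> : gx (gmulT g1 g2) = m_x_id G X \oc w.
  by rewrite /w /m_x_id {2}/prod_map prod_map_pair comp1m compA.
have -> : sg \oc gx g1 \oc a_ g2 = sg \oc (id_x sg \oc w).
  rewrite -compA /a_ /gx prod_map_pair comp1m /id_x pair_comp -!compA.
  have -> : pr23 G X \oc w = gx g2.
    by rewrite /pr23 /w pair_comp pr2_pair -compA pr1_pair compA pr2_pair.
  by rewrite /w pr1_pair compA pr1_pair.
by rewrite !compA act_mul.
Qed.

Lemma p_gx_a (g1 g2 : hom T G) : p \oc gx g1 \oc a_ g2 = sg \oc gx g2.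
Proof. by rewrite {1}/gx /prod_map pr2_pair comp1m /a_ pr2_pair. Qed.

Lemma p_gx (g g' : hom T G) : p \oc gx g = p \oc gx g'.
Proof. by rewrite /gx /prod_map !pr2_pair. Qed.

Definition Gtilde_mul_arr (x1 x2 : Gtilde T) :
    @hom (fiber C (T \x X))
      (pull (gx (gmulT (gt_pt x1) (gt_pt x2))) (pull sg E))
      (pull (gx (gmulT (gt_pt x1) (gt_pt x2))) (pull p E)) :=
  let g1 := gt_pt x1 in let g2 := gt_pt x2 in let g12 := gmulT g1 g2 in
  canon (pbS (gx g2) (pb1 p E)) (pbS (gx g12) (pb1 p E)) (p_gx g2 g12)
    \oc gt_arr x2
    \oc canon (pbS (a_ g2) (pbS (gx g1) (pb1 p E))) (pbS (gx g2) (pb1 sg E))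
          (p_gx_a g1 g2)
    \oc pullm (a_ g2) (gt_arr x1)
    \oc canon (pbS (gx g12) (pb1 sg E)) (pbS (a_ g2) (pbS (gx g1) (pb1 sg E)))
          (s_gx_mul g1 g2).

Lemma Gtilde_mul_iso (x1 x2 : Gtilde T) : is_iso (Gtilde_mul_arr x1 x2).
Proof. by rewrite /Gtilde_mul_arr; iso_tac. Qed.

(* (g1, a1) (g2, a2) = (g1 g2, a2 o a_{g2}^* a1) *)
Definition Gtilde_mul (x1 x2 : Gtilde T) : Gtilde T :=
  GTilde (Gtilde_mul_iso x1 x2).

End GroupLaw.

(* A section of the projection Gtilde -> G, as functors Sch^op -> Set, that is
   a homomorphism on T-points for every T. *)
Record homomorphic_section := HomomorphicSection {
  sec :> forall T : S, hom T G -> Gtilde T;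
  sec_nat : forall (T' T : S) (h : hom T' T) (g : hom T G),
    sec (g \oc h) = Gtilde_res h (sec g);
  sec_proj : forall (T : S) (g : hom T G), gt_pt (sec g) = g;
  sec_mul : forall (T : S) (g1 g2 : hom T G),
    sec (gmulT g1 g2) = Gtilde_mul (sec g1) (sec g2) }.

End Equivariant.

Record opens (X : topologicalType) := Opens {
  oset :> set X;
  osetP : open oset }.

Definition openI_ (X : topologicalType) (U V : opens X) : opens X :=
  Opens (openI (osetP U) (osetP V)).

Definition open_top (X : topologicalType) : opens X := Opens (@openT X).

Record ringed_space := RingedSpace {
  rs_top :> topologicalType;
  sect : opens rs_top -> comPzRingType;
  res : forall U V : opens rs_top, V `<=` U -> {rmorphism sect U -> sect V};
  res_id : forall (U : opens rs_top) (h : U `<=` U) (a : sect U), res h a = a;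
  res_res : forall (U V W : opens rs_top) (h : V `<=` U) (h' : W `<=` V) (h'' : W `<=` U)
    (a : sect U), res h' (res h a) = res h'' a;
  res_sheaf : forall (I : Type) (U : opens rs_top) (V : I -> opens rs_top)
    (VU : forall i, V i `<=` U) (a : forall i, sect (V i)),
    U `<=` \bigcup_i V i ->
    (forall i j, res (@subIsetl _ (V i) (V j) : openI_ (V i) (V j) `<=` V i) (a i)
               = res (@subIsetr _ (V i) (V j) : openI_ (V i) (V j) `<=` V j) (a j)) ->
    exists! b : sect U, forall i, res (VU i) b = a i }.

Arguments sect {r}.
Arguments res {r U V}.

(* The germ of a at x is a unit of the stalk O_x. *)
Definition germ_unit (X : ringed_space) (x : X) (U : opens X) (a : sect U) : Prop :=
  exists (V : opens X) (VU : V `<=` U),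
    oset V x /\ exists b : sect V, res VU a * b = 1.

(* All stalks are local: 1 <> 0, and a sum of two non-units is a non-unit
   (two germs at x are always represented on a common neighbourhood). *)
Definition locally_ringed (X : ringed_space) : Prop :=
  forall (x : X) (U : opens X), oset U x ->
    (1 : sect U) <> 0 /\
    forall a b : sect U, germ_unit x (a + b) -> germ_unit x a \/ germ_unit x b.

(* A map f of spaces with f^# : O_Y -> f_*O_X.  The component of f^# at V is
   given together with its restrictions to the opens U of f^-1(V), so that
   composition needs no transport along equalities of opens. *)
Record lrs_hom (X Y : ringed_space) := LRSHom {
  lmap :> X -> Y;
  lmap_cont : continuous lmap;
  sharp : forall (V : opens Y) (U : opens X), U `<=` lmap @^-1` V ->
    {rmorphism sect V -> sect U};
  sharp_res : forall (V V' : opens Y) (U U' : opens X)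
    (h : U `<=` lmap @^-1` V) (h' : U' `<=` lmap @^-1` V')
    (vv : V' `<=` V) (uu : U' `<=` U) (a : sect V),
    res uu (sharp h a) = sharp h' (res vv a);
  sharp_local : forall (V : opens Y) (U : opens X) (h : U `<=` lmap @^-1` V)
    (x : X) (a : sect V), oset U x -> germ_unit x (sharp h a) -> germ_unit (lmap x) a }.

Arguments sharp {X Y} _ {V U}.

Lemma rmorph_ext (A B : comPzRingType) (f g : {rmorphism A -> B}) :
  (f : A -> B) = g -> f = g.
Proof.
case: f g => f [[f1] [f2]] [g [[g1] [g2]]] /= e; case: _ / e g1 g2 => g1 g2.
by rewrite (Prop_irrelevance f1 g1) (Prop_irrelevance f2 g2).
Qed.

Lemma lrs_hom_ext (X Y : ringed_space) (f g : lrs_hom X Y) :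
  (forall x, f x = g x) ->
  (forall (V : opens Y) (U : opens X) (h : U `<=` f @^-1` V)
     (h' : U `<=` g @^-1` V) (a : sect V), sharp f h a = sharp g h' a) -> f = g.
Proof.
case: f g => f fc fs fr fl [g gc gs gr gl] /= /funext e.
case: _ / e gc gs gr gl => gc gs gr gl es.
have e : fs = gs.
  apply: functional_extensionality_dep => V.
  apply: functional_extensionality_dep => U.
  apply: functional_extensionality_dep => h.
  by apply: rmorph_ext; apply: funext => a; exact: es.
case: _ / e gr gl {es} => gr gl.
by rewrite (Prop_irrelevance gc fc) (Prop_irrelevance gr fr)
           (Prop_irrelevance gl fl).
Qed.

Section LRSCategory.

Lemma id_cont (X : topologicalType) : continuous (@idfun X).
Proof. by move=> x. Qed.

Definition lrs_id (X : ringed_space) : lrs_hom X X.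
Proof.
apply: (@LRSHom X X idfun (@id_cont X) (fun V U h => res h)).
- move=> V V' U U' h h' vv uu a.
  have h'' : U' `<=` V by move=> x /h'/vv.
  by rewrite (res_res _ _ h'') (res_res _ _ h'').
- move=> V U h x a Ux [W [WU [Wx [b ab]]]].
  have WV : W `<=` V by move=> y /WU/h.
  by exists W, WV; split=> //; exists b; rewrite -ab (res_res _ _ WV).
Defined.

Definition opre (X Y : ringed_space) (f : lrs_hom X Y) (V : opens Y) : opens X :=
  Opens (open_comp (fun x _ => @lmap_cont _ _ f x) (osetP V)).

Lemma opre_sub (X Y : ringed_space) (f : lrs_hom X Y) (V : opens Y) :
  opre f V `<=` f @^-1` V.
Proof. by []. Qed.

Lemma comp_cont (X Y Z : ringed_space) (g : lrs_hom Y Z) (f : lrs_hom X Y) :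
  continuous (g \o f).
Proof.
move=> x; apply: (@continuous_comp X Y Z); exact: lmap_cont.
Qed.

Definition comp_sharp (X Y Z : ringed_space) (g : lrs_hom Y Z) (f : lrs_hom X Y)
    (V : opens Z) (U : opens X) (h : U `<=` (g \o f) @^-1` V) :
    {rmorphism sect V -> sect U} :=
  @sharp _ _ f (opre g V) U h \o sharp g (@opre_sub _ _ g V).

Definition lrs_comp (X Y Z : ringed_space) (g : lrs_hom Y Z) (f : lrs_hom X Y) :
  lrs_hom X Z.
Proof.
refine (@LRSHom X Z (g \o f) (@comp_cont _ _ _ g f) (@comp_sharp _ _ _ g f) _ _).
- move=> V V' U U' h h' vv uu a; rewrite /comp_sharp /=.
  have vv' : opre g V' `<=` opre g V by move=> y /vv.
  rewrite (@sharp_res _ _ f _ (opre g V') _ _ _ h' vv' uu); congr (sharp _ _ _).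
  exact: sharp_res.
- move=> V U h x a Ux /sharp_local-/(_ Ux) /sharp_local; apply.
  exact: h.
Defined.

End LRSCategory.

Definition prime_ideal (A : comPzRingType) (p : set A) : Prop :=
  [/\ p 0, forall a b, p a -> p b -> p (a + b), forall a b, p b -> p (a * b),
      ~ p 1 & forall a b, p (a * b) -> p a \/ p b].

Record spec (A : comPzRingType) := Spec {
  sp_ideal :> set A;
  sp_prime : prime_ideal sp_ideal }.

Section SpecTopology.
Variable A : comPzRingType.

HB.instance Definition _ := gen_eqMixin (spec A).
HB.instance Definition _ := gen_choiceMixin (spec A).

(* The complement of V(I). *)
Definition zariski (I : set A) : set (spec A) := 
  [set p : spec A | exists2 a, I a & ~ sp_ideal p a].

Definition zariski_open (W : set (spec A)) : Prop := exists I, W = zariski I.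

Lemma zariski_openT : zariski_open setT.
Proof.
exists setT; apply/seteqP; split=> // p _; exists 1 => //.
by case: (sp_prime p).
Qed.

Lemma zariski_openI : setI_closed zariski_open.
Proof.
move=> _ _ [I ->] [J ->]; exists [set c | exists a b, [/\ I a, J b & c = a * b]].
apply/seteqP; split=> p; case: (sp_prime p) => p0 pD pM p1 pP.
- move=> [[a Ia pa] [b Jb pb]]; exists (a * b); first by exists a, b.
  by move=> /pP [].
- move=> [_ [a [b [Ia Jb ->]]] pab]; split.
  + by exists a => // pa; apply: pab; rewrite mulrC; exact: pM.
  + by exists b => // pb; apply: pab; exact: pM.
Qed.

Lemma zariski_open_bigU (I : Type) (f : I -> set (spec A)) :
  (forall i, zariski_open (f i)) -> zariski_open (\bigcup_i f i).
Proof.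
move=> fo; exists [set a | exists i, [set p : spec A | ~ sp_ideal p a] `<=` f i].
apply/seteqP; split=> p.
- move=> [i _]; have [J fi] := fo i; rewrite fi => -[a Ja pa].
  by exists a => //; exists i; rewrite fi => q qa; exists a.
- by move=> [a [i ai] pa]; exists i => //; exact: ai.
Qed.

HB.instance Definition _ :=
  isOpenTopological.Build (spec A) zariski_openT zariski_openI zariski_open_bigU.

End SpecTopology.

(* The distinguished open D(a). *)
Definition basic_open (A : comPzRingType) (a : A) : set (spec A) :=
  [set p : spec A | ~ sp_ideal p a].

(* f exhibits B as the localization A_a. *)
Definition is_localization (A B : comPzRingType) (a : A) (f : A -> B) : Prop :=
  [/\ exists u, f a * u = 1,
      forall b, exists c n, b * f a ^+ n = f c &
      forall c, f c = 0 -> exists n, a ^+ n * c = 0].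

(* (U, O|U) is isomorphic to Spec A, whose structure sheaf is determined by
   its values A_a on the distinguished opens D(a): j is the homeomorphism of
   Spec A onto U and i the isomorphism on global sections, and the sections
   of O_X over the image of D(a) are A_a. *)
Definition affine_open (X : ringed_space) (U : opens X) : Prop :=
  exists (A : comPzRingType) (j : spec A -> X) (i : {rmorphism A -> sect U}),
    [/\ continuous j, injective j, forall W, open W -> open (j @` W),
        j @` setT = U &
        forall (a : A) (V : opens X) (VU : V `<=` U), V = j @` basic_open a :> set X ->
          is_localization a (res VU \o i)].

Definition is_scheme (X : ringed_space) : Prop :=
  locally_ringed X /\
  forall x : X, exists2 U : opens X, oset U x & affine_open U.

Section Schemes.
Variable k : fieldType.

(* A morphism X -> Spec k is given as a ring morphism k -> O_X(X). *)
Record kscheme := KScheme {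
  ks_space :> ringed_space;
  ks_scheme : is_scheme ks_space;
  ks_str : {rmorphism k -> sect (open_top ks_space)} }.

Definition over_k (X Y : kscheme) (f : lrs_hom X Y) : Prop :=
  forall (h : open_top X `<=` f @^-1` open_top Y) (c : k),
    sharp f h (ks_str Y c) = ks_str X c.

Definition khom (X Y : kscheme) := {f : lrs_hom X Y | over_k f}.

Lemma khom_ext (X Y : kscheme) (f g : khom X Y) : sval f = sval g -> f = g.
Proof. exact: sig_eq. Qed.

Lemma over_k_id (X : kscheme) : over_k (lrs_id X).
Proof. by move=> h c; exact: res_id. Qed.

Lemma over_k_comp (X Y Z : kscheme) (g : lrs_hom Y Z) (f : lrs_hom X Y) :
  over_k g -> over_k f -> over_k (lrs_comp g f).
Proof.
move=> kg kf h c.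
have hg : open_top Y `<=` g @^-1` open_top Z by [].
have hf : open_top X `<=` f @^-1` open_top Y by [].
have sg : opre g (open_top Z) `<=` open_top Y by [].
have sf : open_top X `<=` open_top X by [].
rewrite /= /comp_sharp /= -(kf hf) -(kg hg).
rewrite -[RHS](res_id sf) (@sharp_res _ _ f _ (opre g (open_top Z)) _ _ hf h sg sf).
congr (sharp _ _ _).
have sz : open_top Z `<=` open_top Z by [].
by rewrite (@sharp_res _ _ g _ (open_top Z) _ _ hg (@opre_sub _ _ g _) sz sg) res_id.
Qed.

Definition Sch : category.
Proof.
apply: (@Category kscheme khom
  (fun X => exist _ (lrs_id X) (@over_k_id X))
  (fun X Y Z g f => exist _ (lrs_comp (sval g) (sval f))
                            (over_k_comp (svalP g) (svalP f)))).
- move=> X Y [f kf]; apply: khom_ext; apply: lrs_hom_ext => //= V U h h' a.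
  rewrite /comp_sharp /=.
  have VV : opre (lrs_id Y) V `<=` V by [].
  have UU : U `<=` U by [].
  rewrite -[RHS](res_id UU) (@sharp_res _ _ f V (opre (lrs_id Y) V) U U h' h VV UU).
  congr (sharp _ _ _).
  by rewrite -[LHS](res_id (@subset_refl _ (opre (lrs_id Y) V))) (res_res _ _ VV).
- move=> X Y [f kf]; apply: khom_ext; apply: lrs_hom_ext => //= V U h h' a.
  rewrite /comp_sharp /=.
  rewrite (@sharp_res _ _ f V V _ _ (@opre_sub _ _ f V) h' (@subset_refl _ V) h).
  by rewrite res_id.
- move=> X Y Z W [w kw] [g kg] [f kf]; apply: khom_ext.
  apply: lrs_hom_ext => //= V U h h' a; rewrite /comp_sharp /=.
  set V1 := opre w V.
  have UU : U `<=` U by [].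
  have VV : opre (lrs_comp w g) V `<=` opre g V1 by [].
  have WW : V1 `<=` V1 by [].
  have gV : opre (lrs_comp w g) V `<=` g @^-1` V1 by [].
  rewrite -[LHS](res_id UU) (@sharp_res _ _ f (opre g V1)
            (opre (lrs_comp w g) V) U U h h' VV UU).
  congr (sharp _ _ _).
  rewrite (@sharp_res _ _ g V1 V1 _ _ _ gV WW VV) res_id.
  by rewrite -[RHS](res_id (@subset_refl _ (opre (lrs_comp w g) V)))
       (@sharp_res _ _ g V1 V1 _ _ _ gV WW) res_id.
Defined.

(* U is affine with O_X(U) a finitely generated k-algebra: some finite family of
   sections lies in no proper k-subalgebra. *)
Definition affine_fg (X : kscheme) (U : opens X) : Prop :=
  affine_open U /\
  exists (n : nat) (a : 'I_n -> sect U), forall B : set (sect U),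
    (forall c, B (res (@subsetT _ U : U `<=` open_top X) (ks_str X c))) ->
    (forall i, B (a i)) ->
    (forall b b', B b -> B b' -> B (b + b')) ->
    (forall b b', B b -> B b' -> B (b * b')) -> B = setT.

Definition finite_type (X : kscheme) : Prop :=
  exists (n : nat) (U : 'I_n -> opens X),
    (forall x : X, exists i, oset (U i) x) /\ forall i, affine_fg (U i).

Definition closed_immersion (X Y : ringed_space) (f : lrs_hom X Y) : Prop :=
  [/\ injective f, forall Z, closed Z -> closed (f @` Z) &
      forall (V : opens Y) (a : sect (opre f V)) (y : Y), oset V y ->
        exists (V' : opens Y) (VV : V' `<=` V) (UU : opre f V' `<=` opre f V)
          (b : sect V'), oset V' y /\ sharp f (@opre_sub _ _ f V') b = res UU a].

Variable P : finite_products Sch.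

Definition separated (X : Sch) : Prop :=
  closed_immersion (sval (xpair (idm X) (idm X) : hom X (xprod P X X))).

(* Neither reducedness nor irreducibility is required, so that varieties in
   all the usual senses are covered. *)
Record variety := Variety {
  var_sch :> Sch;
  var_ft : finite_type var_sch;
  var_sep : separated var_sch }.

Record algebraic_group := AlgebraicGroup {
  ag_gp :> group_object P;
  ag_ft : finite_type (gob ag_gp) }.

Record Gvariety (G : algebraic_group) := GVariety {
  gv_var :> variety;
  gv_act : action G gv_var }.

End Schemes.

(* Main.v *)
Require Import Defs.
From mathcomp Require Import all_boot all_algebra.
(* [hom] is to denote the arrows of a category, not linear maps. *)
Import Defs.

Set Implicit Arguments.
Unset Strict Implicit.
Unset Printing Implicit Defensive.

(** Everything here is formal: it holds for a group object acting on an object of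
any category with finite products.

Write p, s : G x X -> X for the projection and the action.  An equivariant
structure is an isomorphism phi : p^*E -> s^*E; put psi = phi^-1.  A section of
Gtilde -> G that is natural in T is determined, as in the Yoneda lemma, by its
value at the universal point id : G -> G, which is an isomorphism
psi : s^*E -> p^*E; its value at g : T -> G is then (g, (g x id)^* psi).
Conversely every psi defines a natural section by this formula.  So it remains
to match the cocycle condition with the homomorphism property.  For
g1, g2 : T -> G let w = (g1, g2) x id : T x X -> G x G x X.  The three arrows
G x G x X -> G x X composed with w are
   (m x id) w = g1 g2 x id,  (id x s) w = (g1 x id) a_{g2},  pr23 w = g2 x id,
so the inverse of the cocycle identity, pulled back along w, reads
   (g1 g2 x id)^* psi = (g2 x id)^* psi o a_{g2}^* (g1 x id)^* psi,
which is the group law of Gtilde.  For T = G x G and g1, g2 the two projections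
w is the identity, so the homomorphism property gives back the cocycle
condition.

The work lies in the canonical identifications of iterated pullbacks.  Here they
are absorbed in a relation, [is_base_change u a b]: the vertical arrow b between
two pullbacks of E is the pullback along u of the vertical arrow a between two
others.  It refers to no chosen pullback and no equality of arrows of the base,
it determines b from a and u, and it is stable under all the
operations that occur ([pullm], composition, inverses, and composition with a
[canon] on either side).  Both the cocycle condition and the group law become
instances of [multiplicative_along], which says that the base changes of psi
along three arrows u12, u1, u2 compose. *)

(** * Base change of vertical arrows between pullbacks *)

Lemma inverse_of_comp (S : category) (A B D : S) (f : hom A D) (g : hom B D)
    (h : hom A B) (f' : hom D A) (g' : hom D B) (h' : hom B A) :
  f \oc f' = idm D -> f' \oc f = idm A -> g' \oc g = idm B ->
  h' \oc h = idm A -> f = g \oc h -> f' = h' \oc g'.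
Proof.
move=> ff' f'f g'g h'h e.
have hgf : h' \oc g' \oc f = idm A.
  by rewrite e compA -(compA h') g'g compm1.
by rewrite -[RHS]compm1 -ff' compA hgf comp1m.
Qed.

Section BaseChange.
Variables (S : category) (C : fibered_category S) (Y : S) (E : C Y).

Lemma pbarr_mono (W : S) (h : hom W Y) (D : pullback h E) (Z : S) (H : C Z)
    (c c' : fhom H (pbob D)) :
  fproj c = fproj c' -> fcomp (pbarr D) c = fcomp (pbarr D) c' -> c = c'.
Proof.
move=> cc' e.
have [d [_ dP]] := pbarr_cartesian (fprojM (pbarr D) c).
by rewrite -(dP c) // -(dP c').
Qed.

(** The comparison arrow between two pullbacks of E; both [canon] and the
cartesian arrows of the cleavage are instances. *)
Definition is_lift (Z W : S) (u : hom Z W) (h1 : hom Z Y) (h : hom W Y)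
    (D1 : pullback h1 E) (D : pullback h E) (c : fhom (pbob D1) (pbob D)) :=
  fproj c = u /\ fcomp (pbarr D) c = pbarr D1.

Arguments is_lift {Z W} u {h1 h} D1 D c.

Lemma lift_exists (Z W : S) (u : hom Z W) (h1 : hom Z Y) (h : hom W Y)
    (D1 : pullback h1 E) (D : pullback h E) :
  h1 = h \oc u -> exists c, is_lift u D1 D c.
Proof.
move=> e; have := @pbarr_cartesian _ _ _ _ _ _ D _ (pbob D1) u (pbarr D1).
by rewrite !pbarr_proj => /(_ e) [c [cP _]]; exists c.
Qed.

Lemma lift_unique (Z W : S) (u : hom Z W) (h1 : hom Z Y) (h : hom W Y)
    (D1 : pullback h1 E) (D : pullback h E) (c c' : fhom (pbob D1) (pbob D)) :
  is_lift u D1 D c -> is_lift u D1 D c' -> c = c'.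
Proof.
by move=> [cu cD] [c'u c'D]; apply: (@pbarr_mono _ _ D); rewrite ?cu ?cD.
Qed.

Lemma lift_comp (V Z W : S) (v : hom V Z) (u : hom Z W)
    (h2 : hom V Y) (h1 : hom Z Y) (h : hom W Y)
    (D2 : pullback h2 E) (D1 : pullback h1 E) (D : pullback h E)
    (c : fhom (pbob D1) (pbob D)) (d : fhom (pbob D2) (pbob D1)) :
  is_lift u D1 D c -> is_lift v D2 D1 d -> is_lift (u \oc v) D2 D (fcomp c d).
Proof.
by move=> [cu cD] [dv dD]; split; [rewrite fprojM cu dv | rewrite fcompA cD].
Qed.

Lemma lift_proj (Z W : S) (u : hom Z W) (h1 : hom Z Y) (h : hom W Y)
    (D1 : pullback h1 E) (D : pullback h E) (c : fhom (pbob D1) (pbob D)) :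
  is_lift u D1 D c -> h1 = h \oc u.
Proof.
by move=> [cu cD]; have := fprojM (pbarr D) c; rewrite cD cu !pbarr_proj.
Qed.

Lemma lift_canon (Z : S) (h h' : hom Z Y) (D : pullback h E)
    (D' : pullback h' E) (e : h = h') :
  is_lift (idm Z) D D' (sval (canon D D' e)).
Proof. by split; [exact: (svalP (canon D D' e)) | exact: canonE]. Qed.

Lemma lift_cart (Z W : S) (u : hom Z W) (h : hom W Y) (D : pullback h E) :
  is_lift u (pbS u D) D (cart u (pbob D)).
Proof. by split; [exact: cart_proj|]. Qed.

(** The arrow b is u^* a up to the canonical identifications.  The equalities
h1 = h u and h1' = h' u are not hypotheses: the existence of the comparison
arrows c and c' implies them, so that no proof of equality enters the
relation. *)
Definition is_base_change (Z W : S) (u : hom Z W)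
    (h h' : hom W Y) (D : pullback h E) (D' : pullback h' E)
    (h1 h1' : hom Z Y) (D1 : pullback h1 E) (D1' : pullback h1' E)
    (a : @hom (fiber C W) (pbob D) (pbob D'))
    (b : @hom (fiber C Z) (pbob D1) (pbob D1')) : Prop :=
  exists (c : fhom (pbob D1) (pbob D)) (c' : fhom (pbob D1') (pbob D')),
    [/\ is_lift u D1 D c, is_lift u D1' D' c' &
        fcomp c' (sval b) = fcomp (sval a) c].

Arguments is_base_change {Z W} u {h h'} D D' {h1 h1'} D1 D1' a b.

Section Properties.
Variables (W : S) (h h' : hom W Y) (D : pullback h E) (D' : pullback h' E).
Variables (a : @hom (fiber C W) (pbob D) (pbob D')).

Lemma base_change_exists (Z : S) (u : hom Z W) (h1 h1' : hom Z Y)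
    (D1 : pullback h1 E) (D1' : pullback h1' E) :
  h1 = h \oc u -> h1' = h' \oc u ->
  exists b, is_base_change u D D' D1 D1' a b.
Proof.
move=> e e'; have [c cP] := lift_exists D1 D e.
have [c' c'P] := lift_exists D1' D' e'.
have := @pbarr_cartesian _ _ _ _ _ _ D1' _ (pbob D1) (idm Z)
  (fcomp (pbarr D') (fcomp (sval a) c)).
rewrite !fprojM !pbarr_proj (svalP a) comp1m (proj1 cP) compm1.
move=> /(_ (esym e')) [b [[b1 bE] _]].
exists (exist _ b b1), c, c'; split=> //=; apply: (@pbarr_mono _ _ D').
- by rewrite !fprojM (proj1 c'P) b1 compm1 (svalP a) comp1m (proj1 cP).
- by rewrite fcompA (proj2 c'P) bE.
Qed.

Lemma base_change_unique (Z : S) (u : hom Z W) (h1 h1' : hom Z Y)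
    (D1 : pullback h1 E) (D1' : pullback h1' E)
    (b b' : @hom (fiber C Z) (pbob D1) (pbob D1')) :
  is_base_change u D D' D1 D1' a b -> is_base_change u D D' D1 D1' a b' ->
  b = b'.
Proof.
move=> [c [c' [cP c'P bE]]] [d [d' [dP d'P b'E]]].
have dc := lift_unique dP cP; have dc' := lift_unique d'P c'P.
subst d d'; apply/vhom_eq/(@pbarr_mono _ _ D1').
- by rewrite (svalP b) (svalP b').
- by rewrite -(proj2 c'P) -!fcompA bE b'E.
Qed.

Lemma base_change_id : is_base_change (idm W) D D' D D' a a.
Proof.
exists (fid (pbob D)), (fid (pbob D')).
by split; rewrite /is_lift ?fproj1 ?fcompm1 ?fcomp1m.
Qed.

Lemma base_change_pullm (Z : S) (u : hom Z W) :
  is_base_change u D D' (pbS u D) (pbS u D') a (pullm u a).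
Proof.
exists (cart u (pbob D)), (cart u (pbob D')).
by split; [exact: lift_cart | exact: lift_cart | exact: pullmE].
Qed.

Lemma base_change_trans (Z V : S) (u : hom Z W) (v : hom V Z)
    (h1 h1' : hom Z Y) (D1 : pullback h1 E) (D1' : pullback h1' E)
    (h2 h2' : hom V Y) (D2 : pullback h2 E) (D2' : pullback h2' E)
    (b : @hom (fiber C Z) (pbob D1) (pbob D1'))
    (d : @hom (fiber C V) (pbob D2) (pbob D2')) :
  is_base_change u D D' D1 D1' a b -> is_base_change v D1 D1' D2 D2' b d ->
  is_base_change (u \oc v) D D' D2 D2' a d.
Proof.
move=> [c [c' [cP c'P bE]]] [x [x' [xP x'P dE]]].
exists (fcomp c x), (fcomp c' x'); split; [exact: lift_comp|exact: lift_comp|].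
by rewrite -fcompA dE !fcompA bE.
Qed.

Lemma base_change_canonl (Z : S) (u : hom Z W)
    (h1 h1' h2 : hom Z Y) (D1 : pullback h1 E) (D1' : pullback h1' E)
    (D2 : pullback h2 E) (e : h1' = h2)
    (b : @hom (fiber C Z) (pbob D1) (pbob D1')) :
  is_base_change u D D' D1 D1' a b ->
  is_base_change u D D' D1 D2 a (canon D1' D2 e \oc b).
Proof.
move=> [c [c' [cP c'P bE]]].
have [d dP] : exists d, is_lift u D2 D' d.
  by apply: lift_exists; rewrite -e; exact: lift_proj c'P.
exists c, d; split=> //=; rewrite fcompA -bE; congr fcomp.
apply: lift_unique c'P; rewrite -[u]compm1.
exact: lift_comp dP (lift_canon _ _ _).
Qed.

Lemma base_change_canonr (Z : S) (u : hom Z W)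
    (h1 h1' h2 : hom Z Y) (D1 : pullback h1 E) (D1' : pullback h1' E)
    (D2 : pullback h2 E) (e : h2 = h1)
    (b : @hom (fiber C Z) (pbob D1) (pbob D1')) :
  is_base_change u D D' D1 D1' a b ->
  is_base_change u D D' D2 D1' a (b \oc canon D2 D1 e).
Proof.
move=> [c [c' [cP c'P bE]]].
exists (fcomp c (sval (canon D2 D1 e))), c'; split=> //=.
- by rewrite -[u]compm1; exact: lift_comp cP (lift_canon _ _ _).
- by rewrite !fcompA bE.
Qed.

End Properties.

(** The arrow b has some base change along v, and by transitivity and uniqueness
it is d. *)
Lemma base_change_cancel (W Z V : S) (u : hom Z W) (v : hom V Z)
    (h h' : hom W Y) (D : pullback h E) (D' : pullback h' E)
    (h1 h1' : hom Z Y) (D1 : pullback h1 E) (D1' : pullback h1' E)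
    (h2 h2' : hom V Y) (D2 : pullback h2 E) (D2' : pullback h2' E)
    (a : @hom (fiber C W) (pbob D) (pbob D'))
    (b : @hom (fiber C Z) (pbob D1) (pbob D1'))
    (d : @hom (fiber C V) (pbob D2) (pbob D2')) :
  is_base_change u D D' D1 D1' a b ->
  is_base_change (u \oc v) D D' D2 D2' a d ->
  is_base_change v D1 D1' D2 D2' b d.
Proof.
move=> ab ad; case: (ab) => c [c' [/lift_proj e /lift_proj e' _]].
case: (ad) => x [x' [/lift_proj f /lift_proj f' _]].
have [||d' bd'] := @base_change_exists _ _ _ D1 D1' b _ v _ _ D2 D2'.
- by rewrite f e -compA.
- by rewrite f' e' -compA.
by rewrite (base_change_unique ad (base_change_trans ab bd')).
Qed.

Lemma base_change_comp (W Z : S) (u : hom Z W)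
    (h h' h'' : hom W Y)
    (D : pullback h E) (D' : pullback h' E) (D'' : pullback h'' E)
    (h1 h1' h1'' : hom Z Y)
    (D1 : pullback h1 E) (D1' : pullback h1' E) (D1'' : pullback h1'' E)
    (a : @hom (fiber C W) (pbob D) (pbob D'))
    (a' : @hom (fiber C W) (pbob D') (pbob D''))
    (b : @hom (fiber C Z) (pbob D1) (pbob D1'))
    (b' : @hom (fiber C Z) (pbob D1') (pbob D1'')) :
  is_base_change u D D' D1 D1' a b ->
  is_base_change u D' D'' D1' D1'' a' b' ->
  is_base_change u D D'' D1 D1'' (a' \oc a) (b' \oc b).
Proof.
move=> [c [c' [cP c'P bE]]] [x [x' [xP x'P dE]]].
have xc := lift_unique xP c'P; subst x.
by exists c, x'; split=> //=; rewrite fcompA dE -!fcompA bE.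
Qed.

Lemma base_change_inverse (W Z : S) (u : hom Z W)
    (h h' : hom W Y) (D : pullback h E) (D' : pullback h' E)
    (h1 h1' : hom Z Y) (D1 : pullback h1 E) (D1' : pullback h1' E)
    (a : @hom (fiber C W) (pbob D) (pbob D'))
    (a' : @hom (fiber C W) (pbob D') (pbob D))
    (b : @hom (fiber C Z) (pbob D1) (pbob D1')) :
  a' \oc a = idm _ -> a \oc a' = idm _ ->
  is_base_change u D D' D1 D1' a b ->
  exists b', [/\ is_base_change u D' D D1' D1 a' b',
                 b' \oc b = idm _ & b \oc b' = idm _].
Proof.
have bc1 (k : hom W Y) (k1 : hom Z Y) (F : pullback k E) (F1 : pullback k1 E) :
    k1 = k \oc u -> is_base_change u F F F1 F1 (idm _) (idm _).
  move=> /(lift_exists F1 F) [c cP].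
  by exists c, c; split=> //=; rewrite fcomp1m fcompm1.
move=> a'a aa' ab; case: (ab) => c [c' [/lift_proj e /lift_proj e' _]].
have [b' ab'] := base_change_exists a' D1' D1 e' e.
exists b'; split=> //.
- apply: base_change_unique (base_change_comp ab ab') _.
  by rewrite a'a; exact: bc1.
- apply: base_change_unique (base_change_comp ab' ab) _.
  by rewrite aa'; exact: bc1.
Qed.

(** The common form of the cocycle condition and of the group law of Gtilde:
u12^* a = u1^* a o u2^* a, read between arbitrary pullbacks D0, D1, D2 of E. *)
Definition multiplicative_along (W : S) (h h' : hom W Y) (D : pullback h E)
    (D' : pullback h' E) (a : @hom (fiber C W) (pbob D) (pbob D'))
    (Z : S) (u12 u1 u2 : hom Z W) : Prop :=
  forall (k0 k1 k2 : hom Z Y)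
    (D0 : pullback k0 E) (D1 : pullback k1 E) (D2 : pullback k2 E) b12 b1 b2,
    is_base_change u12 D D' D0 D2 a b12 ->
    is_base_change u1 D D' D1 D2 a b1 ->
    is_base_change u2 D D' D0 D1 a b2 -> b12 = b1 \oc b2.

Arguments multiplicative_along {W h h'} D D' a {Z} u12 u1 u2.

(** Taking inverses exchanges the two factors; this is why the cocycle of phi
corresponds to the order of factors in the group law, which is about phi^-1. *)
Lemma multiplicative_inverse (W : S) (h h' : hom W Y) (D : pullback h E)
    (D' : pullback h' E) (a : @hom (fiber C W) (pbob D) (pbob D'))
    (a' : @hom (fiber C W) (pbob D') (pbob D))
    (Z : S) (u12 u1 u2 : hom Z W) :
  a' \oc a = idm _ -> a \oc a' = idm _ ->
  multiplicative_along D D' a u12 u1 u2 ->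
  multiplicative_along D' D a' u12 u2 u1.
Proof.
move=> a'a aa' am k0 k1 k2 D0 D1 D2 b12 b1 b2.
move=> /(base_change_inverse aa' a'a) [c12 [ac12 cb12 bc12]].
move=> /(base_change_inverse aa' a'a) [c1 [ac1 cb1 bc1]].
move=> /(base_change_inverse aa' a'a) [c2 [ac2 cb2 bc2]].
exact: inverse_of_comp cb12 bc12 bc2 bc1 (am _ _ _ _ _ _ _ _ _ ac12 ac2 ac1).
Qed.

(** It suffices to check the identity for one choice of the three pullbacks, and
it is then inherited along every v. *)
Lemma multiplicative_comp (W : S) (h h' : hom W Y) (D : pullback h E)
    (D' : pullback h' E) (a : @hom (fiber C W) (pbob D) (pbob D'))
    (Z : S) (u12 u1 u2 : hom Z W) (k0 k1 k2 : hom Z Y)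
    (D0 : pullback k0 E) (D1 : pullback k1 E) (D2 : pullback k2 E) b12 b1 b2
    (V : S) (v : hom V Z) :
  is_base_change u12 D D' D0 D2 a b12 -> is_base_change u1 D D' D1 D2 a b1 ->
  is_base_change u2 D D' D0 D1 a b2 -> b12 = b1 \oc b2 ->
  multiplicative_along D D' a (u12 \oc v) (u1 \oc v) (u2 \oc v).
Proof.
move=> ab12 ab1 ab2 e l0 l1 l2 F0 F1 F2 d12 d1 d2.
move=> /(base_change_cancel ab12) bd12 /(base_change_cancel ab1) bd1.
move=> /(base_change_cancel ab2) bd2.
by apply: base_change_unique bd12 _; rewrite e; exact: base_change_comp bd2 bd1.
Qed.

End BaseChange.

Arguments is_base_change {S C Y E Z W} u {h h'} D D' {h1 h1'} D1 D1' a b.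
Arguments multiplicative_along {S C Y E W h h'} D D' a {Z} u12 u1 u2.

(* The endpoints of a canonical identification are displayed as iterated
   pullbacks, which unification does not match with [pbob D]. *)
Ltac peel_canon :=
  repeat lazymatch goal with
  | |- is_base_change _ _ _ _ _ _ (_ \oc canon ?D2 ?D1 ?e) =>
      refine (base_change_canonr (D1 := D1) D2 e _)
  | |- is_base_change _ _ _ _ _ _ (canon ?D1 ?D2 ?e \oc _) =>
      refine (base_change_canonl (D1' := D1) D2 e _)
  end.

(** * Equivariant structures and sections over a general base category *)

Section Linearization.
Variables (S : category) (P : finite_products S) (G : group_object P) (X : S).
Variables (s : action G X) (C : fibered_category S) (E : C X).
Local Notation "A '\x' B" := (xprod P A B) (at level 40, left associativity).
Local Notation p := (@pr2 S P G X).
Local Notation sg := (act s).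
Local Notation pE := (pb1 p E).
Local Notation sE := (pb1 sg E).

Section Cocycle.
Variable phi : @hom (fiber C (G \x X)) (pull p E) (pull sg E).

(* Pullbacks of E along p pr23 = p (m x id), s pr23 = p (id x s) and
   s (m x id) = s (id x s), between which the three factors of the cocycle
   condition are arrows. *)
Let D0 := pbS (pr23 G X) pE.
Let D1 := pbS (pr23 G X) sE.
Let D2 := pbS (m_x_id G X) sE.

Let phi12 : @hom (fiber C (G \x G \x X)) (pbob D0) (pbob D2) :=
  pullm (m_x_id G X) phi \oc canon D0 (pbS (m_x_id G X) pE) (p_pr23 G X).
Let phi1 : @hom (fiber C (G \x G \x X)) (pbob D1) (pbob D2) :=
  canon (pbS (id_x sg) sE) D2 (act_mul s) \oc pullm (id_x sg) phi
    \oc canon D1 (pbS (id_x sg) pE) (s_pr23 s).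
Let phi2 : @hom (fiber C (G \x G \x X)) (pbob D0) (pbob D1) :=
  pullm (pr23 G X) phi.

Let phi12P : is_base_change (m_x_id G X) pE sE D0 D2 phi phi12.
Proof.
rewrite /phi12; peel_canon; exact: (base_change_pullm (D := pE) (D' := sE)).
Qed.

Let phi1P : is_base_change (id_x sg) pE sE D1 D2 phi phi1.
Proof.
rewrite /phi1; peel_canon; exact: (base_change_pullm (D := pE) (D' := sE)).
Qed.

Let phi2P : is_base_change (pr23 G X) pE sE D0 D1 phi phi2.
Proof. exact: (base_change_pullm (D := pE) (D' := sE)). Qed.

Lemma cocycle_multiplicative (T : S) (t : hom T (G \x G \x X)) :
  cocycle phi ->
  multiplicative_along pE sE phi
    (m_x_id G X \oc t) (id_x sg \oc t) (pr23 G X \oc t).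
Proof.
by move=> /esym e; exact: multiplicative_comp phi12P phi1P phi2P e.
Qed.

Lemma multiplicative_cocycle :
  multiplicative_along pE sE phi (m_x_id G X) (id_x sg) (pr23 G X) ->
  cocycle phi.
Proof. by move=> /(_ _ _ _ _ _ _ _ _ _ phi12P phi1P phi2P)/esym. Qed.

End Cocycle.

Lemma gx_res (T' T : S) (h : hom T' T) (g : hom T G) :
  gx X (g \oc h) = gx X g \oc prod_map P h (idm X).
Proof. by rewrite /gx {2}/prod_map prod_map_pair comp1m compA. Qed.

Section Points.
Variables (T : S) (g1 g2 : hom T G).

(* The arrow (t, x) |-> (g1(t), g2(t), x). *)
Let g12x : hom (T \x X) (G \x G \x X) := prod_map P (xpair g1 g2) (idm X).

Lemma gx_gmulT : gx X (gmulT g1 g2) = m_x_id G X \oc g12x.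
Proof. by rewrite /g12x /m_x_id {2}/prod_map prod_map_pair comp1m compA. Qed.

Lemma gx_pr23 : gx X g2 = pr23 G X \oc g12x.
Proof.
by rewrite /pr23 /g12x pair_comp pr2_pair -compA pr1_pair compA pr2_pair.
Qed.

Lemma gx_a_ : gx X g1 \oc a_ s g2 = id_x sg \oc g12x.
Proof.
rewrite /a_ {1}/gx prod_map_pair comp1m gx_pr23 /id_x pair_comp -!compA.
by congr xpair; rewrite pr1_pair compA pr1_pair.
Qed.

End Points.

(** The arrows of x and y have types that depend on their points, so they cannot
be compared directly; being base changes of one psi along one u is a way to say
that they agree which needs no transport. *)
Lemma Gtilde_ext (T : S) (x y : Gtilde s E T) (e : gt_pt x = gt_pt y) u
    (psi : @hom (fiber C (G \x X)) (pull sg E) (pull p E)) :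
  is_base_change u sE pE (pbS (gx X (gt_pt x)) sE) (pbS (gx X (gt_pt x)) pE)
    psi (gt_arr x) ->
  is_base_change u sE pE (pbS (gx X (gt_pt y)) sE) (pbS (gx X (gt_pt y)) pE)
    psi (gt_arr y) -> x = y.
Proof.
case: x y e => g a ai [g' b bi] /= e; case: _ / e b bi => b bi pa pb.
have e := base_change_unique pa pb; case: _ / e bi => bi {pa pb}.
by rewrite (boolp.Prop_irrelevance ai bi).
Qed.

Section Sections.
Variable psi : @hom (fiber C (G \x X)) (pull sg E) (pull p E).

(** The arrow of x is (g x id)^* psi, where g is the point of x; thus x is the
value at g of the section defined by psi. *)
Definition restricts_to (T : S) (x : Gtilde s E T) : Prop :=
  is_base_change (gx X (gt_pt x)) sE pE
    (pbS (gx X (gt_pt x)) sE) (pbS (gx X (gt_pt x)) pE) psi (gt_arr x).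

Lemma restricts_to_res (T' T : S) (h : hom T' T) (x : Gtilde s E T) :
  restricts_to x -> restricts_to (Gtilde_res h x).
Proof.
move=> xP; rewrite /restricts_to /=.
rewrite [u in is_base_change u]gx_res /Gtilde_res_arr.
peel_canon; apply: base_change_trans xP _.
exact: (base_change_pullm (D := pbS _ sE) (D' := pbS _ pE)).
Qed.

Lemma Gtilde_mul_arr_factor (T : S) (x1 x2 : Gtilde s E T)
    (g1 := gt_pt x1) (g2 := gt_pt x2) (g12 := gmulT g1 g2) :
  restricts_to x1 -> restricts_to x2 ->
  exists b2 b1,
   [/\ is_base_change (gx X g2) sE pE (pbS (gx X g2) sE) (pbS (gx X g12) pE)
         psi b2,
       is_base_change (gx X g1 \oc a_ s g2) sE pE
         (pbS (gx X g12) sE) (pbS (gx X g2) sE) psi b1 &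
       Gtilde_mul_arr x1 x2 = b2 \oc b1].
Proof.
move=> x1P x2P.
exists (canon (pbS (gx X g2) pE) (pbS (gx X g12) pE) (p_gx X g2 g12)
          \oc gt_arr x2).
exists (canon (pbS (a_ s g2) (pbS (gx X g1) pE)) (pbS (gx X g2) sE)
            (p_gx_a s g1 g2)
          \oc pullm (a_ s g2) (gt_arr x1)
          \oc canon (pbS (gx X g12) sE) (pbS (a_ s g2) (pbS (gx X g1) sE))
            (s_gx_mul s g1 g2)).
split; last by rewrite /Gtilde_mul_arr !compA.
- exact: base_change_canonl x2P.
- peel_canon.
  apply: base_change_trans x1P _.
  exact: (base_change_pullm (D := pbS _ sE) (D' := pbS _ pE)).
Qed.

(** When x1 and x2 come from psi, the product arrow is by construction a base
change along g2 x id composed with one along (g1 x id) a_{g2}; so the product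
comes from psi exactly when these compose to the base change along
g1 g2 x id. *)
Lemma restricts_to_mul (T : S) (x1 x2 : Gtilde s E T)
    (g1 := gt_pt x1) (g2 := gt_pt x2) :
  restricts_to x1 -> restricts_to x2 ->
  restricts_to (Gtilde_mul x1 x2) <->
  multiplicative_along sE pE psi
    (gx X (gmulT g1 g2)) (gx X g2) (gx X g1 \oc a_ s g2).
Proof.
move=> x1P x2P; have [b2 [b1 [b2P b1P e]]] := Gtilde_mul_arr_factor x1P x2P.
rewrite /restricts_to /= e; split=> [bP | psim].
- (* Composing with the identity puts the three arrows in the form that
     [multiplicative_comp] concludes about. *)
  rewrite -[X in multiplicative_along _ _ _ X]compm1.
  rewrite -[X in multiplicative_along _ _ _ _ X]compm1.
  rewrite -[X in multiplicative_along _ _ _ _ _ X]compm1.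
  exact: multiplicative_comp bP b2P b1P erefl.
- have [||b12 b12P] := base_change_exists psi
    (D := sE) (D' := pE) (u := gx X (gmulT g1 g2))
    (pbS (gx X (gmulT g1 g2)) sE) (pbS (gx X (gmulT g1 g2)) pE) => //.
  by rewrite -(psim _ _ _ _ _ _ _ _ _ b12P b2P b1P).
Qed.

End Sections.

Lemma equivariant_section :
  equivariant_structure s E -> inhabited (homomorphic_section s E).
Proof.
move=> [phi [psi [psiphi phipsi]] phic].
have psi_iso : is_iso psi by exists phi.
pose f T (g : hom T G) : Gtilde s E T := GTilde (pullm_iso (gx X g) psi_iso).
have fP T (g : hom T G) : restricts_to psi (f T g).
  exact: (base_change_pullm (D := sE) (D' := pE)).
split; apply: (@HomomorphicSection _ _ _ _ s C E f) => //.
- by move=> T' T h g; exact: Gtilde_ext (fP _ _) (restricts_to_res h (fP _ _)).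
- move=> T g1 g2; apply: Gtilde_ext (fP _ _) _ => //.
  apply/restricts_to_mul; [exact: fP|exact: fP|] => /=.
  apply: (multiplicative_inverse (D := pE) (D' := sE) (a := phi)) => //.
  rewrite gx_gmulT gx_a_ (gx_pr23 g1).
  exact: cocycle_multiplicative.
Qed.

(** The isomorphism psi is the value of the section at the universal point
id : G -> G, and the cocycle condition is multiplicativity at the universal pair
of points, the two projections G x G -> G. *)
Lemma section_equivariant :
  homomorphic_section s E -> inhabited (equivariant_structure s E).
Proof.
move=> f; pose x := f _ (idm G).
have gx1 : gx X (gt_pt x) = idm (G \x X).
  by rewrite sec_proj /gx [RHS]pair_uniq /prod_map compm1 comp1m comp1m compm1.
have e (q : hom (G \x X) X) : q = q \oc gx X (gt_pt x) by rewrite gx1 compm1.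
pose psi : @hom (fiber C (G \x X)) (pull sg E) (pull p E) :=
  canon (pbS (gx X (gt_pt x)) pE) pE (esym (e p))
    \oc gt_arr x
    \oc canon sE (pbS (gx X (gt_pt x)) sE) (e sg).
have [phi [phipsi psiphi]] : is_iso psi.
  apply: is_iso_comp (canon_iso sE (pbS (gx X (gt_pt x)) sE) (e sg)).
  apply: is_iso_comp (gt_iso x).
  exact: (canon_iso (pbS (gx X (gt_pt x)) pE) pE (esym (e p))).
(* psi is the base change of the arrow of x along id; cancelling gives the
   converse relation. *)
have xP : restricts_to psi x.
  rewrite /restricts_to [u in is_base_change u]gx1; apply: base_change_cancel.
    rewrite /psi; peel_canon; exact: base_change_id.
  rewrite comp1m; exact: base_change_id.
have fP T (g : hom T G) : restricts_to psi (f T g).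
  by rewrite -[g]comp1m sec_nat; exact: restricts_to_res.
split; apply: (@EquivariantStructure _ _ _ _ s C E phi); first by exists psi.
apply: multiplicative_cocycle.
apply: (multiplicative_inverse (D := sE) (D' := pE) (a := psi)) => //.
have w1 : prod_map P (xpair pr1 pr2) (idm X) = idm (G \x G \x X).
  have -> : xpair pr1 pr2 = idm (G \x G) by rewrite [RHS]pair_uniq !compm1.
  by rewrite [RHS]pair_uniq /prod_map !compm1 !comp1m.
have := fP _ (gmulT pr1 pr2 : hom (G \x G) G); rewrite sec_mul.
move/(restricts_to_mul (fP _ pr1) (fP _ pr2)); rewrite !sec_proj.
by rewrite gx_gmulT gx_a_ (gx_pr23 pr1) w1 !compm1.
Qed.

End Linearization.

Theorem lemma3p12 (k : fieldType) (P : finite_products (Sch k))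
    (G : algebraic_group P) (X : Gvariety G)
    (C : fibered_category (Sch k)) (E : C X) :
  inhabited (equivariant_structure (gv_act X) E) <->
  inhabited (homomorphic_section (gv_act X) E).
Proof.
split=> -[] f; [exact: equivariant_section | exact: section_equivariant].
Qed.
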